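(* Let $k\geq 3$ be odd and let $n\equiv 2\pmod 4$ be sufficiently large (depending on $k$). Let $G$ be a graph obtained from the complete bipartite graph with parts $L$ and $R$, $|L|=|R|=\frac{n}{2}$, by adding inside $L$ the edges of a graph on vertex set $L$ that is nearly $k$-regular and contains no $P_{2k+3}$. Then $\rho(G)<\frac{k+\sqrt{k^2+n^2-4}}{2}$.
   Context: $\rho(G)$ is the largest eigenvalue of the adjacency matrix of $G$. A graph is nearly $k$-regular if all vertices have degree $k$ except one vertex of degree $k-1$. $P_m$ is the path on $m$ vertices. *)

(* Defs.v *)
From mathcomp Require Import all_boot all_order all_algebra.
From mathcomp Require Import complex polyrcf.
From mathcomp Require Import boolp classical_sets reals.

Set Implicit Arguments.
Unset Strict Implicit.
Unset Printing Implicit Defensive.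

Import Order.TTheory GRing.Theory Num.Theory.

Local Open Scope ring_scope.

Record sgraph (V : finType) := SGraph {
  adj :> rel V;
  adj_sym : symmetric adj;
  adj_irr : irreflexive adj
}.

Section Graphs.
Variables L R V W : finType.

Definition complete_bipartite_adj : rel (L + R) :=
  fun x y => match x, y with
             | inl _, inr _ | inr _, inl _ => true
             | _, _ => false
             end.

Lemma complete_bipartite_sym : symmetric complete_bipartite_adj.
Proof. by move=> [x|x] [y|y]. Qed.

Lemma complete_bipartite_irr : irreflexive complete_bipartite_adj.
Proof. by move=> [x|x]. Qed.

Definition complete_bipartite : sgraph (L + R)%type :=
  SGraph complete_bipartite_sym complete_bipartite_irr.

Definition in_left_adj (H : sgraph L) : rel (L + R) :=
  fun x y => match x, y with
             | inl u, inl v => H u v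
             | _, _ => false
             end.

Lemma in_left_sym (H : sgraph L) : symmetric (in_left_adj H).
Proof. by move=> [x|x] [y|y] //=; rewrite adj_sym. Qed.

Lemma in_left_irr (H : sgraph L) : irreflexive (in_left_adj H).
Proof. by move=> [x|x] //=; rewrite adj_irr. Qed.

Definition in_left (H : sgraph L) : sgraph (L + R)%type :=
  SGraph (in_left_sym H) (in_left_irr H).

Lemma edge_union_sym (G H : sgraph V) : symmetric (fun x y => G x y || H x y).
Proof. by move=> x y; rewrite (adj_sym G) (adj_sym H). Qed.

Lemma edge_union_irr (G H : sgraph V) : irreflexive (fun x y => G x y || H x y).
Proof. by move=> x; rewrite !adj_irr. Qed.

Definition edge_union (G H : sgraph V) : sgraph V :=
  SGraph (edge_union_sym G H) (edge_union_irr G H).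

Definition degree (G : sgraph V) (v : V) : nat := #|[set w | G v w]|.

Definition nearly_regular (k : nat) (G : sgraph V) : Prop :=
  exists2 v, (degree G v).+1 = k & forall w, w != v -> degree G w = k.

(* Subgraph containment; the copy of [F] need not be induced. *)
Definition contains (F : sgraph W) (G : sgraph V) : Prop :=
  exists2 f : W -> V, injective f & forall x y, F x y -> G (f x) (f y).

End Graphs.

Section Path.
Variable m : nat.

Definition path_adj : rel 'I_m :=
  fun i j => (i.+1 == j :> nat) || (j.+1 == i :> nat).

Lemma path_sym : symmetric path_adj.
Proof. by move=> i j; rewrite /path_adj orbC. Qed.

Lemma path_irr : irreflexive path_adj.
Proof. by move=> i; rewrite /path_adj orbb -[X in _ == X]add0n -add1n eqn_add2r. Qed.

Definition path_graph : sgraph 'I_m := SGraph path_sym path_irr.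

End Path.

Section SpectralRadius.
Variables (K : realType) (V : finType).

Definition adjmx (G : sgraph V) : 'M[K]_#|V| :=
  \matrix_(i, j) (G (enum_val i) (enum_val j))%:R.

(* The supremum is attained as soon as [V] is nonempty: see [rho_max]. *)
Definition rho (G : sgraph V) : K := sup [set a : K | eigenvalue (adjmx G) a]%classic.

Lemma adjmx_tr (G : sgraph V) : (adjmx G)^T = adjmx G.
Proof. by apply/matrixP => i j; rewrite !mxE adj_sym. Qed.

Local Notation toC := (real_complex K).

Lemma adjmx_eigenvalue_ex (G : sgraph V) :
  (0 < #|V|)%N -> exists a, eigenvalue (adjmx G) a.
Proof.
move=> V0; pose A := map_mx toC (adjmx G).
have [a Aa] := eigenvalue_closed A V0.
have [v vA v0] := eigenvalueP Aa.
have conjA : (map_mx Num.conj A)^T = A.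
  apply/matrixP => i j; rewrite !mxE adj_sym.
  by rewrite !rmorph_nat.
pose w : 'cV_#|V| := (map_mx Num.conj v)^T.
have Aw : A *m w = a^* *: w.
  by rewrite -{1}conjA -trmx_mul -map_mxM vA map_mxZ linearZ.
have : a *: (v *m w) = a^* *: (v *m w).
  by rewrite scalemxAl -vA -mulmxA Aw -scalemxAr.
move=> /matrixP/(_ 0 0); rewrite mxE [in RHS]mxE => /mulIf aE.
have {}aE : a = a^*.
  apply: aE; apply: contraNneq v0 => /eqP; rewrite mxE psumr_eq0; last first.
    by move=> i _; rewrite !mxE mul_conjC_ge0.
  move=> /allP vi; apply/eqP/rowP => i; move: (vi i (mem_index_enum _)).
  by rewrite !mxE mul_conjC_eq0 => /eqP.
exists (complex.Re a).
rewrite -(eigenvalue_map toC) -/A.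
suff /RRe_real ra : a \is Num.real by rewrite /= ra.
by apply/CrealP; rewrite -aE.
Qed.

Lemma rho_max (G : sgraph V) : (0 < #|V|)%N ->
  eigenvalue (adjmx G) (rho G) /\
  forall a, eigenvalue (adjmx G) a -> a <= rho G.
Proof.
move=> V0; have [b Ab] := adjmx_eigenvalue_ex G V0.
pose p := char_poly (adjmx G).
have rE a : eigenvalue (adjmx G) a = (a \in rootsR p).
  rewrite eigenvalue_root_char.
  by have /(_ a) := roots_on_rootsR (monic_neq0 (char_poly_monic (adjmx G))).
have br : (b \in rootsR p) = true by rewrite -rE.
pose i0 := Ordinal (etrans (index_mem b (rootsR p)) br).
pose i := [arg max_(i > i0) (rootsR p)`_i]%O.
have [m Am mub] : exists2 m, eigenvalue (adjmx G) m &
    forall a, eigenvalue (adjmx G) a -> a <= m.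
  exists (rootsR p)`_i; first by rewrite rE mem_nth.
  move=> a; rewrite rE => ar0; have := ar0; rewrite -index_mem => ar; rewrite /i.
  case: arg_maxP => // j _ /(_ (Ordinal ar) isT) /=.
  by rewrite nth_index.
suff -> : rho G = m by [].
apply/eqP; rewrite eq_le; apply/andP; split.
  by apply: ge_sup => [|a /=]; [exists b | exact: mub].
by apply: ub_le_sup => //; exists m => a /=; exact: mub.
Qed.

End SpectralRadius.

(* Main.v *)
Require Import Defs.
From mathcomp Require Import all_boot all_order all_algebra reals.
From mathcomp Require Import lra ring zify.

Import Order.TTheory GRing.Theory Num.Theory.

Local Open Scope ring_scope.

(** Let [m = n / 2], let [a] be the largest eigenvalue, [x] an eigenvector,
    [s] its sum over [L] and [c] its sum over [R], so that [a * c = m * s].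
    Summing the eigenvalue equations over [L] gives
    [a ^ 2 - k * a = m ^ 2 - a * x v / s], where [v] is the vertex of degree
    [k - 1]. Looking at a minimal entry of [x] on [L] shows
    [x v >= c / (a - (k - 1))], hence [a ^ 2 - k * a <= m ^ 2 - m / (a - k + 1)].
    If [a] were at least the claimed bound, then [a ^ 2 - k * a >= m ^ 2 - 1],
    which forces [a >= m + k - 1]; this contradicts [a * (a - k) <= m ^ 2] as
    soon as [k >= 3] and [m >= 3]. *)

Lemma adjmx_eigenfunction (K : realType) (V : finType) (G : sgraph V) (a : K) :
  eigenvalue (adjmx K G) a ->
  exists2 f : V -> K, exists x, f x != 0 &
    forall x, a * f x = \sum_y (G x y)%:R * f y.
Proof.
move=> /eigenvalueP[v vA /rV0Pn[i vi]].
exists (fun x => v 0 (enum_rank x)); first by exists (enum_val i); rewrite enum_valK.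
move=> x; move/matrixP: vA => /(_ 0 (enum_rank x)); rewrite !mxE => <-.
rewrite (reindex _ (onW_bij _ (enum_rank_bij V))) /=.
by apply: eq_bigr => y _; rewrite mxE !enum_rankK mulrC (adj_sym G).
Qed.

Lemma sum_adj_degree (K : realType) (V : finType) (H : sgraph V) (u : V) :
  \sum_w (H u w)%:R = (degree H u)%:R :> K.
Proof.
rewrite /degree -sum1_card natr_sum [RHS]big_mkcond /=.
by apply: eq_bigr => w _; rewrite inE; case: (H u w).
Qed.

(** At a vertex [w] minimizing [g], all neighbours have value at least [g w], so
    [(a - degree H w) * g w >= c]. *)
Lemma resolvent_lower_bound (K : realType) (V : finType) (H : sgraph V)
    (a b c d : K) (g : V -> K) :
  0 <= c -> d < a ->
  (forall u, b <= (degree H u)%:R <= d) ->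
  (forall u, a * g u = \sum_w (H u w)%:R * g w + c) ->
  forall u, c / (a - b) <= g u.
Proof.
move=> c0 da deg eq_g u.
suff [w wmin gw] : exists2 w, g w <= g u & c / (a - b) <= g w by apply: le_trans wmin.
have [w _ wmin] := @arg_minP _ K V u xpredT g isT; exists w; first exact: wmin.
have /andP[bw wd] := deg w.
have : (degree H w)%:R * g w + c <= a * g w.
  rewrite eq_g lerD2r -sum_adj_degree mulr_suml ler_sum // => t _.
  by rewrite ler_wpM2l ?ler0n ?wmin.
move=> le_w.
(* This sign allows the degree of [w] to be lowered to [b]. *)
have gw0 : 0 <= g w by nra.
rewrite ler_pdivrMr; nra.
Qed.

Section JoinEigenvalue.

Variables (K : realType) (L R : finType) (H : sgraph L) (k : nat) (v : L).
Hypotheses (deg_v : (degree H v).+1 = k)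
           (deg_w : forall w, w != v -> degree H w = k).

Let G := edge_union (complete_bipartite L R) (in_left R H).

(** Double counting: each [g w] occurs [degree H w] times, and only [v] falls one short of [k]. *)
Lemma nearly_regular_sum (g : L -> K) :
  \sum_u \sum_w (H u w)%:R * g w = k%:R * \sum_u g u - g v.
Proof.
rewrite exchange_big /= mulr_sumr [in RHS](bigD1 v) // [LHS](bigD1 v) //=.
have degE w : \sum_i (H i w)%:R * g w = (degree H w)%:R * g w.
  rewrite -mulr_suml -sum_adj_degree; congr (_ * _).
  by apply: eq_bigr => i _; rewrite adj_sym.
rewrite degE -deg_v -natr1.
rewrite (eq_bigr (fun i => (degree H v).+1%:R * g i)) => [|w wv].
  by rewrite -natr1; ring.
by rewrite degE deg_w // deg_v.
Qed.

Lemma join_eigenvalue_bound (a : K) :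
  k%:R < a -> eigenvalue (adjmx K G) a ->
  a ^+ 2 - k%:R * a <= #|L|%:R * #|R|%:R - #|R|%:R / (a - k%:R + 1).
Proof.
move=> ka /adjmx_eigenfunction [f f_neq0 eq_f].
have a0 : 0 < a by apply: le_lt_trans ka; rewrite ler0n.
wlog s0 : f f_neq0 eq_f / 0 <= \sum_u f (inl u).
  move=> base; case: (leP 0 (\sum_u f (inl u))) => [|s_neg]; first exact: base.
  apply: (base (fun x => - f x)).
  - by have [x fx] := f_neq0; exists x; rewrite oppr_eq0.
  - move=> x; rewrite mulrN eq_f -sumrN; apply: eq_bigr => y _.
    by rewrite mulrN.
  - by rewrite sumrN oppr_ge0 ltW.
set s := \sum_u f (inl u) in s0; pose c := \sum_r f (inr r).
have eq_R r : a * f (inr r) = s.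
  rewrite eq_f big_sumType /= [X in _ + X]big1 ?addr0 => [|t _]; last by rewrite mul0r.
  by apply: eq_bigr => u _; rewrite mul1r.
have eq_L u : a * f (inl u) = \sum_w (H u w)%:R * f (inl w) + c.
  rewrite eq_f big_sumType /=; congr (_ + _).
  by apply: eq_bigr => t _; rewrite mul1r.
have eq_c : a * c = #|R|%:R * s.
  by rewrite mulr_sumr (eq_bigr _ (fun r _ => eq_R r)) sumr_const mulr_natl.
have c0 : 0 <= c by rewrite -(pmulr_rge0 _ a0) eq_c mulr_ge0 ?ler0n.
have lbL u : c / (a - (k%:R - 1)) <= f (inl u).
  apply: (@resolvent_lower_bound _ _ H a _ c k%:R (f \o inl)) => // w.
  have [->|wv] := eqVneq w v; last by rewrite deg_w // lexx andbT; lra.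
  by rewrite -deg_v -natr1; apply/andP; split; lra.
have ak1 : 0 < a - k%:R + 1 by lra.
have akE : a - (k%:R - 1) = a - k%:R + 1 by ring.
(* If [s = 0], then [f] vanishes on [R] by [eq_R], and on [L] as a nonnegative function with zero
   sum, so [f] would be zero. *)
have s_gt0 : 0 < s.
  rewrite lt_neqAle s0 andbT; apply/negP => /eqP sE.
  have f0 u : 0 <= f (inl u) by apply: le_trans (lbL u); rewrite akE divr_ge0 // ltW.
  have [[u|r]] := f_neq0; last by have /eqP := eq_R r; rewrite -sE mulf_eq0 gt_eqF //= => ->.
  move/esym/eqP: sE; rewrite /s psumr_eq0 => [/allP/(_ u (mem_index_enum _)) /= ->|] //.
have eq_s : a * s = k%:R * s - f (inl v) + #|L|%:R * c.
  rewrite {1}/s mulr_sumr (eq_bigr _ (fun u _ => eq_L u)) big_split /=.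
  by rewrite (nearly_regular_sum (f \o inl)) sumr_const -[c *+ _]mulr_natl.
have : a * (c / (a - k%:R + 1)) <= a * f (inl v) by rewrite -akE ler_wpM2l // ltW.
rewrite mulrA eq_c mulrAC => le_v.
rewrite -(ler_pM2r s_gt0).
have -> : (a ^+ 2 - k%:R * a) * s = #|L|%:R * #|R|%:R * s - a * f (inl v).
  rewrite -[_ * _ * s]mulrA -eq_c; transitivity (a * (a * s) - k%:R * a * s); first by ring.
  by rewrite eq_s; ring.
by rewrite mulrBl lerD2l lerN2.
Qed.

End JoinEigenvalue.

Theorem theorem4p5 (K : realType) (k : nat) (k_ge3 : (3 <= k)%N) (k_odd : odd k) :
  exists n0 : nat, forall n : nat, (n0 <= n)%N -> n = 2 %[mod 4] ->
  forall (L R : finType) (H : sgraph L),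
    #|L| = (n %/ 2)%N -> #|R| = (n %/ 2)%N ->
    nearly_regular k H ->
    ~ contains (path_graph (2 * k + 3)%N) H ->
    rho K (edge_union (complete_bipartite L R) (in_left R H)) <
      (k%:R + Num.sqrt (k%:R ^+ 2 + n%:R ^+ 2 - 4)) / 2.
Proof.
(* The threshold 6 ensures [m >= 3]; the congruence makes [n] even. *)
exists 6%N => n n6 n2 L R H cardL cardR [v deg_v deg_w] _.
set m := (n %/ 2)%N in cardL cardR.
have nE : n = (2 * m)%N by rewrite /m; lia.
have m3 : (3 <= m)%N by rewrite /m; lia.
have V0 : (0 < #|{: L + R}|)%N by rewrite card_sum cardL; lia.
have [+ _] := rho_max K (edge_union (complete_bipartite L R) (in_left R H)) V0.
set a := rho K _ => eig_a.
have M3 : 3 <= m%:R :> K by rewrite (ler_nat K 3).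
have k3 : 3 <= k%:R :> K by rewrite (ler_nat K 3).
rewrite nE natrM; set M := m%:R in M3 *; set q := k%:R in k3 *.
set r := Num.sqrt _.
have r2 : r ^+ 2 = q ^+ 2 + (2 * M) ^+ 2 - 4 by rewrite sqr_sqrtr //; nra.
have r0 : 0 <= r by exact: sqrtr_ge0.
have qr : q < r by nra.
rewrite ltNge; apply/negP => le_a.
have ra : r <= 2 * a - q by lra.
have qa : q < a by lra.
(* Square [ra], insert [r2] and divide by 4. *)
have lower : M ^+ 2 - 1 <= a ^+ 2 - q * a by nra.
have := join_eigenvalue_bound K L R H k v deg_v deg_w a qa eig_a.
rewrite cardL cardR -/M -/q; set t := M / _ => upper.
have aq1 : 0 < a - q + 1 by lra.
have tE : t * (a - q + 1) = M by rewrite divfK // gt_eqF.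
(* Compare [lower] with [upper]; with [tE] this then yields [M <= a - q + 1]. *)
have t1 : t <= 1 by nra.
have t0 : 0 <= t by rewrite divr_ge0 ?ler0n // ltW.
have le_Ma : M + q - 1 <= a by nra.
have grow : (M + q - 1) * (M - 1) <= a * (a - q).
  by apply: ler_pM; lra.
(* The excess of [(M + q - 1) * (M - 1)] over [M ^+ 2] is this product plus [M + 2 * q - 8], hence
   positive. *)
have prod_ge0 : 0 <= (q - 3) * (M - 3) by apply: mulr_ge0; rewrite subr_ge0.
move: upper; apply/negP; rewrite -ltNge; lra.
Qed.
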